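(* Let $A\in\mathcal D$. Then $c(R(P),R(Q))=c(N(P),N(Q))$ for every $(P,Q)\in\mathcal D_A$, and this quantity (the cosine of the Friedrichs angle) is constant for all $(P,Q)\in\mathcal D_A$.
   Context: Let $\mathcal H$ be a complex Hilbert space, $\mathcal P(\mathcal H)$ the set of orthogonal projections in $\mathcal H$, $\mathcal D=\{P-Q: P,Q\in\mathcal P(\mathcal H)\}$, and for $A\in\mathcal D$ let $\mathcal D_A=\{(P,Q)\in\mathcal P(\mathcal H)\times\mathcal P(\mathcal H): P-Q=A\}$. $R(T)$ and $N(T)$ denote range and nullspace. For closed subspaces $\mathcal M,\mathcal N\subset\mathcal H$, the Friedrichs angle between them is the angle in $[0,\pi/2]$ whose cosine is $$c(\mathcal M,\mathcal N)=\sup\{|\langle\mu,\nu\rangle|:\mu\in\mathcal M\ominus\mathcal N,\ \nu\in\mathcal N\ominus\mathcal M,\ \|\mu\|=\|\nu\|=1\}=\|P_{\mathcal M}P_{\mathcal N}-P_{\mathcal M\cap\mathcal N}\|,$$ where $\mathcal M\ominus\mathcal N=\mathcal M\cap(\mathcal M\cap\mathcal N)^\perp$, $P_{\mathcal M}$ is the orthogonal projection onto $\mathcal M$, and the supremum of the empty set is $0$. *)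

(* Defs.v *)
From HB Require Import structures.
From mathcomp Require Import all_boot all_order all_algebra.
From mathcomp Require Import complex.
From mathcomp Require Import all_classical all_reals all_analysis.

Set Implicit Arguments.
Unset Strict Implicit.
Unset Printing Implicit Defensive.

Import Order.TTheory GRing.Theory Num.Theory.
Import numFieldNormedType.Exports.

Local Open Scope classical_set_scope.
Local Open Scope complex_scope.
Local Open Scope ring_scope.

(* Both the norm and the inner product take values in R[i]; the norm is a
   nonnegative real element of R[i]. The inner product is linear in its first
   argument. *)
HB.mixin Record CompleteNormedModule_isHilbert (R : realType) (H : Type)
    of CompleteNormedModule R[i] H := {
  hdot : {dot H for (@Num.conj R[i])} ;
  sqr_norm_hdot : forall x : H, `|x| ^+ 2 = hdot x x
}.

#[short(type="hilbertType")]
HB.structure Definition Hilbert (R : realType) :=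
  {H of CompleteNormedModule R[i] H & CompleteNormedModule_isHilbert R H}.

Section FriedrichsAngle.
Context {R : realType} {H : hilbertType R}.
Implicit Types (M N : set H) (A : H -> H) (P Q : {linear H -> H}).

Definition orthocompl M : set H :=
  [set x | forall y, M y -> hdot x y = 0].

Definition ominus M N : set H := M `&` orthocompl (M `&` N).

(* [sup set0 = 0] in the library; by Cauchy-Schwarz the set below is bounded
   by 1, so the default value of [sup] on unbounded sets is never used. *)
Definition friedrichs_cos M N : R :=
  sup [set r : R | exists mu nu : H,
    [/\ ominus M N mu, ominus N M nu, `|mu| = 1, `|nu| = 1
      & r%:C = `|hdot mu nu| ]].

Definition nullspace P : set H := P @^-1` [set 0].

Definition orthoprojs : set {linear H -> H} :=
  [set P | [/\ continuous P,
               (forall x : H, P (P x) = P x)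
             & (forall x y : H, hdot (P x) y = hdot x (P y))]].

Definition proj_pairs A : set ({linear H -> H} * {linear H -> H}) :=
  [set PQ | [/\ orthoprojs PQ.1, orthoprojs PQ.2 & PQ.1 \- PQ.2 = A]].

Definition proj_diffs : set (H -> H) :=
  [set A | exists P Q, [/\ orthoprojs P, orthoprojs Q & A = P \- Q]].

End FriedrichsAngle.

(* Main.v *)
Require Import Defs.
From mathcomp Require Import all_boot all_order all_algebra.
From mathcomp Require Import complex.
From mathcomp Require Import all_classical all_reals all_analysis.
From mathcomp Require Import ring lra.
Local Open Scope classical_set_scope.
Local Open Scope ring_scope.

Import Order.TTheory GRing.Theory Num.Theory.
Import numFieldNormedType.Exports.
Local Open Scope complex_scope.

Set Implicit Arguments.
Unset Strict Implicit.
Unset Printing Implicit Defensive.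

Local Notation Re := complex.Re.

(* Write M = R(P), N = R(Q), A = P - Q. The cosine c(M, N) is the least k >= 0
   with |Q x| <= k |x| for all x in M orthogonal to M /\ N.

   c(M^perp, N^perp) <= k := c(M, N): this is clear if k >= 1. Otherwise let y in
   M^perp be orthogonal to M^perp /\ N^perp and T = (1 - P)(1 - Q)(1 - P). Then
   PQ intertwines T on M^perp with PQ on M, where PQ has norm at most k^2 on
   vectors orthogonal to M /\ N, so |T^(n+1) y - T^(n+2) y| <= C k^(2n). By
   completeness T^n y converges, to a fixed point of T, i.e. to an element of
   M^perp /\ N^perp, which must be 0; hence |T^(n+1) y| <= C' k^(2n). As
   |T^n y| is log-convex in n, this forces |T y| <= k^2 |y|, and therefore
   |(1 - Q) y|^2 = <T y, y> <= k^2 |y|^2. No spectral theorem is needed.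

   Independence of (P, Q): if x in R(P') is orthogonal to R(P') /\ R(Q'), it is
   orthogonal to N(A), and |Q' x|^2 = |x|^2 - |A x|^2. Since A^2 commutes with
   P, |A x|^2 splits along x = P x + (1 - P) x, and the bounds for (M, N) and
   (M^perp, N^perp) give |A x|^2 >= (1 - k^2) |x|^2. *)

(** * Real-valued norm and inner product, Cauchy-Schwarz *)

Section RealInnerProduct.
Context {R : realType} {H : hilbertType R}.
Implicit Types (x y z : H) (a r : R).

(** Moving from [R[i]] to [R] makes ordered-field reasoning available; [Re] loses nothing on the
    norm, which is real. *)
Definition rnorm x : R := Re `|x|.
Definition rdot x y : R := Re (hdot x y).

Lemma rnormE x : `|x| = (rnorm x)%:C.
Proof. by rewrite /rnorm RRe_real// normr_real. Qed.

Lemma rnorm_ge0 x : 0 <= rnorm x.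
Proof. by rewrite -ler0c -rnormE. Qed.

Lemma rnorm_eq0 x : rnorm x = 0 -> x = 0.
Proof. by move=> x0; apply/normr0_eq0; rewrite rnormE x0. Qed.

Lemma rnormD x y : rnorm (x + y) <= rnorm x + rnorm y.
Proof. by rewrite -lecR rmorphD/= -!rnormE ler_normD. Qed.

Lemma rnormN x : rnorm (- x) = rnorm x.
Proof. by rewrite /rnorm normrN. Qed.

Lemma rnormZ (c : R[i]) x : rnorm (c *: x) = Re `|c| * rnorm x.
Proof.
apply: complexI; rewrite -rnormE normrZ rnormE rmorphM/=.
by rewrite (RRe_real (normr_real c)).
Qed.

Lemma rdotxx x : rdot x x = rnorm x ^+ 2.
Proof. by apply: complexI; rewrite /rdot -sqr_norm_hdot rnormE -rmorphXn. Qed.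

Lemma hdotC x y : hdot x y = (hdot y x)^*.
Proof. by rewrite hermC expr0 mul1r. Qed.

Lemma hdotBl x y z : hdot (x - y) z = hdot x z - hdot y z.
Proof. exact: linearBl. Qed.

Lemma hdotBr x y z : hdot x (y - z) = hdot x y - hdot x z.
Proof. exact: linearBr. Qed.

Lemma hdotZl (c : R[i]) x y : hdot (c *: x) y = c * hdot x y.
Proof. exact: linearZl_LR. Qed.

Lemma hdotZr (c : R[i]) x y : hdot x (c *: y) = conjc c * hdot x y.
Proof. exact: linearZr_LR. Qed.

Lemma rdotC x y : rdot x y = rdot y x.
Proof. by rewrite /rdot hdotC; case: (hdot y x). Qed.

Lemma rdotBl x y z : rdot (x - y) z = rdot x z - rdot y z.
Proof. by rewrite /rdot linearBl raddfB. Qed.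

Lemma rdotBr x y z : rdot x (y - z) = rdot x y - rdot x z.
Proof. by rewrite rdotC rdotBl !(rdotC x). Qed.

Lemma rdotZl a x y : rdot (a%:C *: x) y = a * rdot x y.
Proof.
rewrite /rdot linearZl_LR/=; case: (hdot x y) => u v /=.
by rewrite mul0r subr0.
Qed.

Lemma rdotZr a x y : rdot x (a%:C *: y) = a * rdot x y.
Proof. by rewrite rdotC rdotZl rdotC. Qed.

Lemma rdot_le x y : rdot x y <= rnorm x * rnorm y.
Proof.
have [x0|x0] := eqVneq (rnorm x) 0.
  by rewrite x0 mul0r (rnorm_eq0 x0) /rdot linear0l.
have [y0|y0] := eqVneq (rnorm y) 0.
  by rewrite y0 mulr0 (rnorm_eq0 y0) /rdot linear0r.
have xy0 : 0 < rnorm x * rnorm y by rewrite mulr_gt0// lt0r rnorm_ge0 ?x0 ?y0.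
(* The expanded square is [2 |x| |y| (|x| |y| - rdot x y)], and its first factors are positive. *)
have := sqr_ge0 (rnorm ((rnorm y)%:C *: x - (rnorm x)%:C *: y)).
rewrite -rdotxx rdotBl !rdotBr !rdotZl !rdotZr !rdotxx (rdotC y x).
rewrite (_ : _ - _ = 2 * (rnorm x * rnorm y) * (rnorm x * rnorm y - rdot x y)).
  by rewrite pmulr_rge0 ?subr_ge0// mulr_gt0.
by ring.
Qed.

Lemma norm_hdot_le x y : `|hdot x y| <= (rnorm x * rnorm y)%:C.
Proof.
have [r rE] : exists r, `|hdot x y| = r%:C.
  by exists (Re `|hdot x y|); rewrite RRe_real// normr_real.
have r_ge0 : 0 <= r by rewrite -ler0c -rE.
rewrite rE lecR.
have [->|r0] := eqVneq r 0; first by rewrite mulr_ge0 ?rnorm_ge0.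
(* rotating x by the conjugate phase makes the inner product real *)
have := rdot_le ((hdot x y)^* *: x) y.
rewrite rnormZ normcJ rE /= /rdot linearZl_LR/= mulrC -sqr_normc rE -rmorphXn/=.
by rewrite -mulrA expr2 ler_pM2l// lt0r r0.
Qed.

End RealInnerProduct.

(** * Geometric convergence and iterates of a self-adjoint contraction *)

Lemma geometric_le0 (R : realType) (q K a : R) : 0 <= q -> q < 1 ->
  (forall n, a <= K * q ^+ n) -> a <= 0.
Proof.
move=> q0 q1 aK.
have qcvg : (fun n => K * q ^+ n) @ \oo --> (0 : R).
  rewrite -(mulr0 K); apply: cvgM; first exact: cvg_cst.
  by apply: cvg_expr; rewrite ger0_norm.
rewrite -(cvg_lim (@Rhausdorff R) qcvg).
by apply: limr_ge; [apply/cvg_ex; exists 0 | apply: nearW].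
Qed.

Section ContractionPowers.
Context {R : realType} {H : hilbertType R}.
Implicit Types (x y z : H).

Lemma geometric_steps_le (u : nat -> H) (q K : R) : 0 <= q -> q < 1 ->
  (forall n, rnorm (u n - u n.+1) <= K * q ^+ n) ->
  forall n m, rnorm (u n - u (m + n)%N) <= K / (1 - q) * q ^+ n.
Proof.
move=> q0 q1 uK n m.
have K0 : 0 <= K by have := le_trans (rnorm_ge0 _) (uK 0%N); rewrite expr0 mulr1.
have q1' : 0 < 1 - q by rewrite subr_gt0.
(* The exact partial geometric sum is what the induction on [m] can carry. *)
suff /le_trans : rnorm (u n - u (m + n)%N) <= K / (1 - q) * (q ^+ n - q ^+ (m + n)).
  apply; rewrite ler_wpM2l ?divr_ge0 ?(ltW q1')// gerBl exprn_ge0//.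
elim: m => [|m IHm]; first by rewrite add0n !subrr mulr0 /rnorm normr0.
have -> : u n - u (m.+1 + n)%N =
    (u n - u (m + n)%N) + (u (m + n)%N - u (m + n).+1).
  by rewrite addrA subrK.
apply: (le_trans (rnormD _ _)); apply: (le_trans (lerD IHm (uK _))).
rewrite addSn exprS le_eqVlt; apply/orP; left; apply/eqP.
by field; rewrite lt0r_neq0.
Qed.

(** Completeness of [H] enters here: the tail bound makes [u] Cauchy and survives in the limit. *)
Lemma geometric_steps_cvg (u : nat -> H) (q K : R) : 0 <= q -> q < 1 ->
  (forall n, rnorm (u n - u n.+1) <= K * q ^+ n) ->
  exists l, forall n, rnorm (u n - l) <= K / (1 - q) * q ^+ n.
Proof.
move=> q0 q1 uK; have uL := geometric_steps_le q0 q1 uK.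
have K0 : 0 <= K by have := le_trans (rnorm_ge0 _) (uK 0%N); rewrite expr0 mulr1.
have q1' : 0 < 1 - q by rewrite subr_gt0.
have : cvg (u @ \oo).
  apply: cauchy_cvg; apply: cauchy_exP => e e0.
  have [r re] : exists r, e = r%:C.
    by exists (Re e); rewrite RRe_real// gtr0_real.
  have r0 : 0 < r by rewrite -ltcR -re.
  have [N NP] : exists N, K / (1 - q) * q ^+ N < r.
    apply: contrapT => /forallNP Nr.
    have : r <= 0.
      by apply: (geometric_le0 q0 q1) => n; rewrite leNgt; apply/negP/Nr.
    by rewrite leNgt r0.
  exists (u N); exists N => // n /= Nn.
  rewrite -ball_normE /= rnormE re ltcR -(subnK Nn).
  exact: le_lt_trans (uL _ _) NP.
move=> /cvg_ex[l ul]; exists l => n.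
rewrite -subr_le0; apply/ler_addgt0Pl => e e0.
have /cvgrPdist_lt/(_ e%:C) := ul; rewrite ltcR => /(_ e0)[N _ Nl].
have := Nl (N + n)%N (leq_addr _ _); rewrite /= rnormE ltcR => lN.
rewrite addr0 lerBlDr.
have -> : u n - l = (u n - u (N + n)%N) - (l - u (N + n)%N).
  by rewrite opprB addrA subrK.
apply: (le_trans (rnormD _ _)); rewrite rnormN addrC.
by apply: lerD (uL _ _); apply/ltW.
Qed.

(* Cauchy-Schwarz makes [n |-> rnorm (T ^ n y)] log-convex, so its ratios are
   nondecreasing and the first of them is at most the decay rate [q]. *)
Lemma selfadjoint_decay_le (T : {linear H -> H}) (y : H) (q K : R) :
  0 <= q -> (forall x z, rdot (T x) z = rdot x (T z)) ->
  (forall n, rnorm (iter n.+1 T y) <= K * q ^+ n) ->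
  rnorm (T y) <= q * rnorm y.
Proof.
move=> q0 Tsa TK; rewrite leNgt; apply/negP => qlt.
have [y0|y0] := eqVneq (rnorm y) 0.
  by move: qlt; rewrite (rnorm_eq0 y0) linear0 /rnorm normr0 mulr0 ltxx.
have {}y0 : 0 < rnorm y by rewrite lt0r y0 rnorm_ge0.
pose rho := rnorm (T y) / rnorm y.
have qrho : q < rho by rewrite ltr_pdivlMr.
have rho0 : 0 < rho by exact: le_lt_trans qrho.
have ratio n : 0 < rnorm (iter n T y) /\
    rho * rnorm (iter n T y) <= rnorm (iter n.+1 T y).
  elim: n => [|n [n0 nle]]; first by split=> //=; rewrite divfK// gt_eqF.
  have Sn0 : 0 < rnorm (iter n.+1 T y) by apply: lt_le_trans nle; rewrite mulr_gt0.
  split=> //; rewrite -(ler_pM2l n0).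
  (* Self-adjointness turns this inner product into [|T^(n+1) y|^2]. *)
  have := rdot_le (iter n T y) (iter n.+2 T y).
  rewrite [iter n.+2 _ _]/= -Tsa -[T (iter n T y)]/(iter n.+1 T y) rdotxx.
  by apply: le_trans; rewrite mulrA [_ * rho]mulrC expr2 ler_wpM2r ?rnorm_ge0.
have grow n : rho ^+ n * rnorm y <= rnorm (iter n T y).
  elim: n => [|n IHn]; first by rewrite expr0 mul1r.
  by apply: le_trans (ratio n).2; rewrite exprS -mulrA ler_pM2l.
(* From [rho^(n+1) |y| <= |T^(n+1) y| <= K q^n], dividing by [rho^n] leaves
   [rho |y| <= K (q / rho)^n], with [q / rho < 1]. *)
have : rho * rnorm y <= 0.
  apply: (@geometric_le0 _ (q / rho) K).
  - by rewrite divr_ge0// ltW.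
  - by rewrite ltr_pdivrMr// mul1r.
  move=> n; rewrite expr_div_n mulrA ler_pdivlMr ?exprn_gt0//.
  apply: le_trans (TK n); apply: le_trans (grow n.+1).
  by rewrite exprSr mulrC mulrA.
by rewrite leNgt mulr_gt0.
Qed.

Lemma selfadjoint_steps_le (T : {linear H -> H}) (y : H) (q K : R) :
  0 <= q -> q < 1 -> (forall x z, rdot (T x) z = rdot x (T z)) ->
  (forall x, rnorm (T x) <= rnorm x) ->
  (forall z, T z = z -> rdot y z = 0) ->
  (forall n, rnorm (iter n.+1 T y - iter n.+2 T y) <= K * q ^+ n) ->
  rnorm (T y) <= q * rnorm y.
Proof.
move=> q0 q1 Tsa T1 yfix TK.
have [l ul] := geometric_steps_cvg (u := fun n => iter n.+1 T y) q0 q1 TK.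
set L := K / (1 - q) in ul.
have Tl : T l = l.
  apply/eqP; rewrite -subr_eq0; apply/eqP/rnorm_eq0/eqP.
  rewrite eq_le rnorm_ge0 andbT; apply: (geometric_le0 (K := 2 * L) q0 q1) => n.
  (* Both terms on the right are errors of approximation to [l], the second one under the
     contraction [T]. *)
  have -> : T l - l = (iter n.+2 T y - l) - T (iter n.+1 T y - l).
    by rewrite linearB/= opprB [RHS]addrC addrA subrK.
  apply: (le_trans (rnormD _ _)); rewrite rnormN.
  have := lerD (ul n.+1) (le_trans (T1 _) (ul n)).
  move=> /le_trans; apply.
  have : L * q ^+ n.+1 <= L * q ^+ n.
    rewrite ler_wpM2l//; last by rewrite exprS ler_piMl ?exprn_ge0// ltW.
    by have := le_trans (rnorm_ge0 _) (ul 0%N); rewrite expr0 mulr1.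
  lra.
have ul0 n : rdot (iter n T y) l = 0.
  by elim: n => [|n IHn] /=; [exact: yfix | rewrite Tsa Tl].
have l0 : l = 0.
  apply/rnorm_eq0/eqP; rewrite -sqrf_eq0 eq_le sqr_ge0 andbT.
  apply: (geometric_le0 (K := L * rnorm l) q0 q1) => n.
  (* All iterates are orthogonal to [l], so one may be subtracted for free and the error bound
     applies. *)
  have -> : rnorm l ^+ 2 = rdot (l - iter n.+1 T y) l.
    by rewrite rdotBl ul0 subr0 rdotxx.
  apply: (le_trans (rdot_le _ _)); rewrite -rnormN opprB mulrAC.
  by rewrite ler_wpM2r ?rnorm_ge0.
apply: (selfadjoint_decay_le (K := L)) => // n.
by have := ul n; rewrite l0 subr0.
Qed.

End ContractionPowers.

(** * Orthogonal projections and their complements *)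

Section Projections.
Context {R : realType} {H : hilbertType R}.
Implicit Types (P Q : {linear H -> H}) (x y z : H) (k : R).

Definition selfadjoint_idempotent P : Prop :=
  (forall x, P (P x) = P x) /\ (forall x y, hdot (P x) y = hdot x (P y)).

(** Being a linear map, it can take the place of [P] in every lemma on projections, with range and
    nullspace exchanged. *)
Definition complproj P : {linear H -> H} := idfun \- P.

Lemma complprojE P x : complproj P x = x - P x. Proof. by []. Qed.

Lemma complproj_selfadjoint_idempotent P :
  selfadjoint_idempotent P -> selfadjoint_idempotent (complproj P).
Proof.
move=> [PP Psa]; split=> [x|x y].
  by rewrite !complprojE linearB/= PP subrr subr0.
by rewrite !complprojE hdotBl hdotBr Psa.
Qed.

Lemma orthoprojs_selfadjoint_idempotent P :
  orthoprojs P -> selfadjoint_idempotent P.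
Proof. by case. Qed.

Lemma range_proj P : selfadjoint_idempotent P -> range P = [set x | P x = x].
Proof.
by move=> [PP _]; apply/seteqP; split=> [_ [x _ <-]//|x Px]; exists x.
Qed.

Lemma range_complproj P :
  selfadjoint_idempotent P -> range (complproj P) = nullspace P.
Proof.
move=> Pp; rewrite range_proj; last exact: complproj_selfadjoint_idempotent.
apply/seteqP; split=> x; rewrite /nullspace /=.
  by move=> /(canRL (subrK _))/esym/(canRL (addKr _)); rewrite addNr.
by move=> ->; rewrite subr0.
Qed.

Lemma nullspace_complproj P :
  selfadjoint_idempotent P -> nullspace (complproj P) = range P.
Proof.
move=> Pp; rewrite range_proj//; apply/seteqP; split=> x;
  rewrite /nullspace /=.
  by move/eqP; rewrite subr_eq0 => /eqP/esym.
by move=> ->; rewrite subrr.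
Qed.

Lemma rdot_proj P x y :
  selfadjoint_idempotent P -> rdot (P x) y = rdot x (P y).
Proof. by move=> [_ Psa]; rewrite /rdot Psa. Qed.

Lemma rdot_projxx P x :
  selfadjoint_idempotent P -> rdot (P x) x = rnorm (P x) ^+ 2.
Proof. by move=> Pp; rewrite -rdotxx -{1}(Pp.1 x) rdot_proj. Qed.

Lemma rnorm_pythagoras P x : selfadjoint_idempotent P ->
  rnorm x ^+ 2 = rnorm (P x) ^+ 2 + rnorm (x - P x) ^+ 2.
Proof.
move=> Pp; rewrite -!rdotxx !rdotBl !rdotBr (rdotC x (P x)) rdot_projxx// !rdotxx.
by ring.
Qed.

Lemma rnorm_proj_le P x : selfadjoint_idempotent P -> rnorm (P x) <= rnorm x.
Proof.
move=> Pp; rewrite -(@ler_pXn2r _ 2) ?nnegrE ?rnorm_ge0//.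
by rewrite [leRHS](rnorm_pythagoras _ Pp) lerDl sqr_ge0.
Qed.

(** Pythagoras leaves no room for [x - P x]. This serves to identify the fixed points of a product
    of projections. *)
Lemma rnorm_proj_eq P x : selfadjoint_idempotent P ->
  rnorm x <= rnorm (P x) -> P x = x.
Proof.
move=> Pp; rewrite -(@ler_pXn2r _ 2) ?nnegrE ?rnorm_ge0//.
rewrite [leLHS](rnorm_pythagoras _ Pp) gerDl => h.
apply/esym/eqP; rewrite -subr_eq0; apply/eqP/rnorm_eq0/eqP.
by rewrite -sqrf_eq0 eq_le h sqr_ge0.
Qed.

(** * The Friedrichs cosine as a bound on one projection *)

Definition perp_common_range P Q x : Prop :=
  forall z, P z = z -> Q z = z -> hdot x z = 0.

(** For [0 <= k] this amounts to [friedrichs_cos (range P) (range Q) <= k]: for fixed [x], the best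
    [nu] points along [Q x]. *)
Definition proj_angle_bound k P Q : Prop :=
  forall x, P x = x -> perp_common_range P Q x -> rnorm (Q x) <= k * rnorm x.

Lemma ominus_rangeP P Q x :
  selfadjoint_idempotent P -> selfadjoint_idempotent Q ->
  ominus (range P) (range Q) x <-> P x = x /\ perp_common_range P Q x.
Proof.
move=> Pp Qp; rewrite /ominus !range_proj//; split=> -[Px xperp]; split=> //.
  by move=> z Pz Qz; apply: xperp.
by move=> z [Pz Qz]; apply: xperp.
Qed.

Lemma perp_common_rangeC P Q x :
  perp_common_range P Q x -> perp_common_range Q P x.
Proof. by move=> h z Qz Pz; apply: h. Qed.

Lemma perp_common_range_projl P Q x : selfadjoint_idempotent P ->
  perp_common_range P Q x -> perp_common_range P Q (P x).
Proof. by move=> [_ Psa] h z Pz Qz; rewrite Psa Pz h. Qed.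

Lemma perp_common_range_projr P Q x : selfadjoint_idempotent Q ->
  perp_common_range P Q x -> perp_common_range P Q (Q x).
Proof. by move=> [_ Qsa] h z Pz Qz; rewrite Qsa Qz h. Qed.

Definition friedrichs_set (M N : set H) := [set r : R | exists mu nu : H,
  [/\ ominus M N mu, ominus N M nu, `|mu| = 1, `|nu| = 1
    & r%:C = `|hdot mu nu| ]].

Lemma friedrichs_set_le1 (M N : set H) r : friedrichs_set M N r -> r <= 1.
Proof.
move=> [mu [nu [_ _ mu1 nu1 rE]]]; rewrite -lecR rE.
apply: (le_trans (norm_hdot_le _ _)).
by rewrite rmorphM/= -!rnormE mu1 nu1 mulr1.
Qed.

Lemma le_friedrichs_cos (M N : set H) mu nu r :
  ominus M N mu -> ominus N M nu -> `|mu| = 1 -> `|nu| = 1 ->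
  r%:C = `|hdot mu nu| -> r <= friedrichs_cos M N.
Proof.
move=> Mmu Nnu mu1 nu1 rE; apply: ub_le_sup; last by exists mu, nu.
by exists 1 => s /friedrichs_set_le1.
Qed.

Lemma friedrichs_cos_le (M N : set H) k : 0 <= k ->
  (forall mu nu, ominus M N mu -> ominus N M nu -> `|mu| = 1 -> `|nu| = 1 ->
     `|hdot mu nu| <= k%:C) ->
  friedrichs_cos M N <= k.
Proof.
move=> k0 kub; rewrite /friedrichs_cos -/(friedrichs_set M N).
(* The empty set has supremum [0], which is where [0 <= k] enters. *)
have [->|/set0P ne] := eqVneq (friedrichs_set M N) set0; first by rewrite sup0.
by apply: ge_sup => // r [mu [nu [? ? ? ? rE]]]; rewrite -lecR rE kub.
Qed.

Lemma friedrichs_cos_ge0 (M N : set H) : 0 <= friedrichs_cos M N.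
Proof.
have [e|/set0P [r rS]] := eqVneq (friedrichs_set M N) set0.
  by rewrite /friedrichs_cos -/(friedrichs_set M N) e sup0.
move: rS => [mu [nu [a b c d rE]]].
apply: le_trans (le_friedrichs_cos a b c d rE).
by rewrite -ler0c rE.
Qed.

Lemma proj_angle_bound_friedrichs_cos P Q :
  selfadjoint_idempotent P -> selfadjoint_idempotent Q ->
  proj_angle_bound (friedrichs_cos (range P) (range Q)) P Q.
Proof.
move=> Pp Qp x Px xperp; set c := friedrichs_cos _ _.
have [Qx0|Qx0] := eqVneq (rnorm (Q x)) 0.
  by rewrite Qx0 mulr_ge0 ?rnorm_ge0 ?friedrichs_cos_ge0.
have {}Qx0 : 0 < rnorm (Q x) by rewrite lt0r Qx0 rnorm_ge0.
have x0 : 0 < rnorm x by exact: lt_le_trans (rnorm_proj_le x Qp).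
have normalized y : 0 < rnorm y -> `|(rnorm y)^-1%:C *: y| = 1.
  move=> y0; rewrite rnormE rnormZ normc_def/= expr0n addr0 sqrtr_sqr.
  by rewrite ger0_norm ?invr_ge0 ?rnorm_ge0// mulVf// gt_eqF.
rewrite -ler_pdivrMr//.
apply: (@le_friedrichs_cos _ _ ((rnorm x)^-1%:C *: x) ((rnorm (Q x))^-1%:C *: Q x)).
- apply/ominus_rangeP => //; split; first by rewrite linearZ/= Px.
  by move=> z Pz Qz; rewrite hdotZl xperp// mulr0.
- apply/ominus_rangeP => //; split; first by rewrite linearZ/= Qp.1.
  move=> z Pz Qz; rewrite hdotZl.
  by rewrite (perp_common_range_projr Qp xperp)// mulr0.
- exact: normalized.
- exact: normalized.
(* Since [hdot x (Q x) = |Q x|^2], the normalized pair yields exactly [|Q x| / |x|]. *)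
rewrite hdotZl hdotZr -{3}(Qp.1 x) -Qp.2 -sqr_norm_hdot rnormE.
rewrite conjc_real -rmorphXn -!rmorphM/= ger0_norm.
  by congr _%:C; field; rewrite !gt_eqF.
by rewrite ler0c !mulr_ge0 ?invr_ge0 ?exprn_ge0 ?rnorm_ge0.
Qed.

Lemma friedrichs_cos_le_proj_angle_bound P Q k :
  selfadjoint_idempotent P -> selfadjoint_idempotent Q -> 0 <= k ->
  proj_angle_bound k P Q -> friedrichs_cos (range P) (range Q) <= k.
Proof.
move=> Pp Qp k0 kPQ; apply: friedrichs_cos_le => // mu nu.
move=> /(ominus_rangeP _ Pp Qp)[Pmu muperp] /(ominus_rangeP _ Qp Pp)[Qnu _].
rewrite !rnormE => -[mu1] -[nu1].
(* As [nu] lies in the range of [Q], [mu] may be replaced by [Q mu]. *)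
rewrite -Qnu -Qp.2; apply: (le_trans (norm_hdot_le _ _)).
by rewrite lecR nu1 mulr1; have := kPQ _ Pmu muperp; rewrite mu1 mulr1.
Qed.

(** * Passing to the orthogonal complements *)

Lemma proj_angle_bound_compl P Q k :
  selfadjoint_idempotent P -> selfadjoint_idempotent Q -> 0 <= k ->
  proj_angle_bound k P Q -> proj_angle_bound k (complproj P) (complproj Q).
Proof.
move=> Pp Qp k0 kPQ y Py yperp.
have P1p := complproj_selfadjoint_idempotent Pp.
have Q1p := complproj_selfadjoint_idempotent Qp.
have [k1|k1] := leP 1 k.
  apply: (le_trans (rnorm_proj_le y Q1p)).
  by rewrite ler_peMl ?rnorm_ge0.
have {}Py : P y = 0.
  by move: Py; rewrite complprojE => /(canRL (subrK _))/esym/(canRL (addKr _));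
    rewrite addNr.
pose T : {linear H -> H} := complproj P \o complproj Q \o complproj P.
have TdefE u : T u = complproj P (complproj Q (complproj P u)) by [].
have TE u : P u = 0 -> T u = u - Q u + P (Q u).
  by move=> Pu; rewrite TdefE !complprojE Pu subr0 linearB/= Pu sub0r opprK.
have P_iter n : P (iter n T y) = 0.
  by case: n => [|n] //; rewrite iterS TdefE !complprojE linearB/= Pp.1 subrr.
(* [w] transports the orbit of [T] into the range of [P], where the hypothesis on [k] applies; [wS]
   is the intertwining relation. *)
pose w n := P (Q (iter n T y)).
have wS n : w n.+1 = P (Q (w n)).
  by rewrite /w iterS TE// linearD linearB/= Qp.1 subrr add0r.
have wperp n : perp_common_range P Q (w n).
  elim: n => [|n IHn]; last first.
    rewrite wS; apply: perp_common_range_projl => //.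
    exact: perp_common_range_projr.
  move=> z Pz Qz; rewrite /w/= Pp.2 Pz Qp.2 Qz -Pz -Pp.2 Py.
  exact: linear0l.
(* The bound is used twice: [|P Q x|^2 = rdot (Q (P (Q x))) (Q x)], which is at most [k |P Q x|]
   times [k |x|]. *)
have kPQP x : P x = x -> perp_common_range P Q x ->
    rnorm (P (Q x)) <= k ^+ 2 * rnorm x.
  move=> Px xperp; have [u0|u0] := eqVneq (rnorm (P (Q x))) 0.
    by rewrite u0 mulr_ge0 ?sqr_ge0 ?rnorm_ge0.
  have {}u0 : 0 < rnorm (P (Q x)) by rewrite lt0r u0 rnorm_ge0.
  rewrite -(ler_pM2l u0) -expr2 -rdot_projxx// -{2}(Qp.1 x) -rdot_proj//.
  apply: (le_trans (rdot_le _ _)).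
  have h1 := kPQ _ (Pp.1 (Q x))
    (perp_common_range_projl Pp (perp_common_range_projr Qp xperp)).
  have h2 := kPQ _ Px xperp.
  apply: (le_trans (ler_pM (rnorm_ge0 _) (rnorm_ge0 _) h1 h2)).
  by rewrite expr2; lra.
have w_le n : rnorm (w n) <= rnorm (w 0%N) * (k ^+ 2) ^+ n.
  elim: n => [|n IHn]; first by rewrite expr0 mulr1.
  rewrite wS; apply: (le_trans (kPQP _ _ (wperp n))); first by rewrite /w Pp.1.
  by rewrite (exprS _ n) mulrCA ler_wpM2l ?sqr_ge0.
(* For [v = T u] with [P u = 0], [v - T v = (1 - P) Q v] and [Q v = Q P Q u]. The latter requires
   one application of [T], hence the start at [n.+1]. *)
have step n : iter n.+1 T y - iter n.+2 T y = complproj P (Q (w n)).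
  rewrite (iterS n.+1) (TE (iter n.+1 T y))// complprojE -wS.
  rewrite opprD opprB addrA addrCA subrr addr0 -/(w n.+1); congr (_ - _).
  by rewrite iterS TE// linearD linearB/= Qp.1 subrr add0r.
have Tsa x z : rdot (T x) z = rdot x (T z).
  by rewrite TdefE !rdot_proj.
have T1 x : rnorm (T x) <= rnorm x.
  apply: (le_trans (rnorm_proj_le _ P1p)); apply: (le_trans (rnorm_proj_le _ Q1p)).
  exact: rnorm_proj_le.
have Tfix z : T z = z -> rdot y z = 0.
  move=> Tz; rewrite /rdot yperp//.
    by rewrite -Tz TdefE P1p.1.
  have P1z : complproj P z = z by rewrite -Tz TdefE P1p.1.
  (* [|z| = |T z| <= |(1 - Q) z|] forces [(1 - Q) z = z]. *)
  apply: rnorm_proj_eq => //; rewrite -{1}Tz TdefE P1z.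
  exact: rnorm_proj_le.
have TK n : rnorm (iter n.+1 T y - iter n.+2 T y) <= rnorm (w 0%N) * (k ^+ 2) ^+ n.
  rewrite step; apply: (le_trans _ (w_le n)).
  by apply: (le_trans (rnorm_proj_le _ P1p)); apply: rnorm_proj_le.
have k21 : k ^+ 2 < 1 by rewrite expr_lt1.
have := selfadjoint_steps_le (sqr_ge0 k) k21 Tsa T1 Tfix TK => Ty.
rewrite -(@ler_pXn2r _ 2) ?nnegrE ?mulr_ge0 ?rnorm_ge0//.
have P1y : complproj P y = y by rewrite complprojE Py subr0.
have -> : rnorm (complproj Q y) ^+ 2 = rdot (T y) y.
  by rewrite TdefE rdot_proj// P1y rdot_projxx.
apply: (le_trans (rdot_le _ _)); rewrite exprMn [rnorm y ^+ 2]expr2 mulrA.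
by rewrite ler_wpM2r ?rnorm_ge0.
Qed.

Lemma friedrichs_cos_nullspace_le P Q :
  selfadjoint_idempotent P -> selfadjoint_idempotent Q ->
  friedrichs_cos (nullspace P) (nullspace Q)
    <= friedrichs_cos (range P) (range Q).
Proof.
move=> Pp Qp; rewrite -!range_complproj//.
apply: friedrichs_cos_le_proj_angle_bound;
  [exact: complproj_selfadjoint_idempotent..|exact: friedrichs_cos_ge0|].
by apply: proj_angle_bound_compl => //;
  [exact: friedrichs_cos_ge0|exact: proj_angle_bound_friedrichs_cos].
Qed.

Lemma friedrichs_cos_nullspace P Q :
  selfadjoint_idempotent P -> selfadjoint_idempotent Q ->
  friedrichs_cos (nullspace P) (nullspace Q)
    = friedrichs_cos (range P) (range Q).
Proof.
move=> Pp Qp; apply/eqP; rewrite eq_le friedrichs_cos_nullspace_le//=.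
(* The reverse inequality is the same one applied to the complements, whose nullspaces are the
   original ranges. *)
rewrite -(nullspace_complproj Pp) -(nullspace_complproj Qp).
rewrite -(range_complproj Pp) -(range_complproj Qp).
by apply: friedrichs_cos_nullspace_le; exact: complproj_selfadjoint_idempotent.
Qed.

(** * Independence of the pair with a given difference *)

(* Holds because [(P - Q) ^ 2] commutes with [P]. *)
Lemma rnorm_projB P Q x :
  selfadjoint_idempotent P -> selfadjoint_idempotent Q ->
  rnorm (P x - Q x) ^+ 2 =
    (rnorm (P x) ^+ 2 - rnorm (Q (P x)) ^+ 2) +
    (rnorm (complproj P x) ^+ 2 - rnorm (complproj Q (complproj P x)) ^+ 2).
Proof.
move=> Pp Qp; have := rnorm_pythagoras (complproj P x) Qp.
rewrite -complprojE -(rdot_projxx (P x) Qp) -(rdot_projxx (complproj P x) Qp).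
move=> ->; rewrite !complprojE linearB/= -!rdotxx !rdotBl !rdotBr.
rewrite (rdot_proj (P x) x Qp) (rdotC (Q x) (P x)) [rdot (Q x) (Q x)]rdotxx.
by rewrite (rdot_projxx x Qp); ring.
Qed.

Lemma friedrichs_cos_range_le P Q P' Q' :
  selfadjoint_idempotent P -> selfadjoint_idempotent Q ->
  selfadjoint_idempotent P' -> selfadjoint_idempotent Q' ->
  P \- Q = P' \- Q' ->
  friedrichs_cos (range P') (range Q') <= friedrichs_cos (range P) (range Q).
Proof.
move=> Pp Qp P'p Q'p eqA; set k := friedrichs_cos (range P) _.
have k0 : 0 <= k by exact: friedrichs_cos_ge0.
have kPQ : proj_angle_bound k P Q by exact: proj_angle_bound_friedrichs_cos.
have kPQ1 := proj_angle_bound_compl Pp Qp k0 kPQ.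
have eqAx x : P x - Q x = P' x - Q' x by have := congr1 (@^~ x) eqA.
apply: friedrichs_cos_le_proj_angle_bound => // x P'x xperp.
(* If [P z = Q z], then [P' z = Q' z] lies in both primed ranges, and [hdot x z = hdot x (P' z)]. *)
have xker z : P z = Q z -> hdot x z = 0.
  move=> PQz; have P'Q'z : P' z = Q' z.
    by apply/eqP; rewrite -subr_eq0 -eqAx PQz subrr.
  by rewrite -P'x P'p.2 xperp ?P'p.1// P'Q'z Q'p.1.
have h1 : rnorm (Q (P x)) <= k * rnorm (P x).
  apply: kPQ; first exact: Pp.1.
  by apply: perp_common_range_projl => // z Pz Qz; rewrite xker// Pz Qz.
have h2 : rnorm (complproj Q (complproj P x)) <= k * rnorm (complproj P x).
  have P1p := complproj_selfadjoint_idempotent Pp.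
  apply: kPQ1; first exact: P1p.1.
  (* A vector of both nullspaces also satisfies [P z = Q z], so [xker] covers it. *)
  apply: perp_common_range_projl => // z.
  rewrite !complprojE => Pz Qz; apply: xker; apply: oppr_inj.
  by apply: (addrI z); rewrite Pz Qz.
have nA := rnorm_projB x Pp Qp.
have nA' := rnorm_pythagoras x Q'p.
have nP := rnorm_pythagoras x Pp.
rewrite eqAx P'x in nA; rewrite -complprojE in nP.
(* Here [x - Q' x] is the common difference applied to [x]; [|x|^2] cancels between the Pythagoras
   identities for [P] and [Q']. *)
have Q'xE : rnorm (Q' x) ^+ 2 =
    rnorm (Q (P x)) ^+ 2 + rnorm (complproj Q (complproj P x)) ^+ 2 by lra.
have sqr_le (u v : H) : rnorm u <= k * rnorm v ->
    rnorm u ^+ 2 <= k ^+ 2 * rnorm v ^+ 2.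
  by rewrite -exprMn => uv; rewrite lerXn2r ?nnegrE ?mulr_ge0 ?rnorm_ge0.
rewrite -(@ler_pXn2r _ 2) ?nnegrE ?mulr_ge0 ?rnorm_ge0//.
by rewrite exprMn Q'xE nP mulrDr lerD ?sqr_le.
Qed.

End Projections.

Theorem proposition2p6 (R : realType) (H : hilbertType R) (A : H -> H)
    (hA : proj_diffs A) :
  (forall P Q : {linear H -> H}, proj_pairs A (P, Q) ->
     friedrichs_cos (range P) (range Q)
     = friedrichs_cos (nullspace P) (nullspace Q)) /\
  (forall P Q P' Q' : {linear H -> H},
     proj_pairs A (P, Q) -> proj_pairs A (P', Q') ->
     friedrichs_cos (range P) (range Q)
     = friedrichs_cos (range P') (range Q')).
Proof.
have sai := @orthoprojs_selfadjoint_idempotent R H.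
split=> [P Q [/= /sai Pp /sai Qp _]|P Q P' Q'].
  by rewrite friedrichs_cos_nullspace.
move=> [/= /sai Pp /sai Qp PQA] [/= /sai P'p /sai Q'p P'Q'A].
by apply/eqP; rewrite eq_le !friedrichs_cos_range_le// PQA P'Q'A.
Qed.
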